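(* Consider the system $$\dot{x}(t) = Ax(t) + f_u(U_\delta(t),Y_\tau(t)) + D f_g(x(t),U_\delta(t),Y_\tau(t)) + f_L(x(t),U_\delta(t),Y_\tau(t)),\qquad y(t)=Cx(t),$$ where $f_L$ is globally Lipschitz in its first argument with constant $\gamma>0$, i.e. $$\|f_L(x_1,U,Y)-f_L(x_2,U,Y)\|\le \gamma\|x_1-x_2\|\quad\text{for all } x_1,x_2,U,Y,$$ and the cubic observer $$\dot{w}(t) = Gw(t)+Jy(t)+(I-EC)f_u(U_\delta(t),Y_\tau(t))+(I-EC)f_L(\hat{x}(t),U_\delta(t),Y_\tau(t)) - \big(e_c(t)^TC^T\theta C e_c(t)\big)\,NCe_c(t),\qquad \hat{x}(t)=w(t)+Ey(t),$$ with $e_c(t)=x(t)-\hat{x}(t)$ and $\theta=\theta^T\ge 0$. Suppose that all of the following hold: 1. there is no $v\in\mathbb{R}^n$, $v\neq 0$, with $Gv+(v^TC^T\theta Cv)\,NCv=0$; 2. there exist a symmetric positive definite matrix $P=P^T>0$ and a scalar $\beta>0$ such that $$\begin{bmatrix} PG+G^TP+\gamma^2\beta I & P(I-EC)\\ (I-EC)^TP & -\beta I\end{bmatrix}<0 \qquad\text{and}\qquad PNC+C^TN^TP<0;$$ 3. $(I-EC)A-JC-G(I-EC)=0$; 4. $(I-EC)D=0$. Then the dynamics of the estimation error $e_c$ is globally stable.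
   Context: Here $x(t)\in\mathbb{R}^n$ is the state, $u(t)$ the (vector) input, $y(t)\in\mathbb{R}^{n_y}$ the measured output; $A\in\mathbb{R}^{n\times n}$, $C\in\mathbb{R}^{n_y\times n}$, and $D$ is a real matrix with $n$ rows. For fixed delays $\delta_1,\dots,\delta_{m_u},\tau_1,\dots,\tau_{m_y}\ge 0$, $U_\delta(t)$ is the stacked vector of $u(t-\delta_1),\dots,u(t-\delta_{m_u})$ and $Y_\tau(t)$ is the stacked vector of $y(t-\tau_1),\dots,y(t-\tau_{m_y})$. The functions $f_u$ (of delayed inputs and outputs) and $f_g$ (of the state and of delayed inputs and outputs) are general nonlinear functions of compatible dimensions, and $f_L$ takes values in $\mathbb{R}^n$. The observer has intermediate state $w(t)\in\mathbb{R}^n$, state estimate $\hat{x}(t)\in\mathbb{R}^n$, and real constant parameter matrices $G\in\mathbb{R}^{n\times n}$, $J,E,N\in\mathbb{R}^{n\times n_y}$, $\theta\in\mathbb{R}^{n_y\times n_y}$. $I$ is the identity matrix of appropriate size, $\|\cdot\|$ is the Euclidean norm, and for symmetric matrices $M<0$ (resp. $M>0$, $M\ge 0$) means negative definite (resp. positive definite, positive semidefinite). The estimation error dynamics is the differential equation satisfied by $e_c(t)=x(t)-\hat{x}(t)$ along solutions of the system and the observer. ''Globally stable'' means that the equilibrium $e_c=0$ of the error dynamics is globally asymptotically stable: it is Lyapunov stable, and $e_c(t)\to 0$ as $t\to\infty$ for every initial error (solutions of the system and the observer being assumed to exist for all $t\ge 0$). *)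

(* Defs.v *)
From mathcomp Require Import all_boot all_order all_algebra.
From mathcomp Require Import all_classical all_reals all_analysis.

Set Implicit Arguments.
Unset Strict Implicit.
Unset Printing Implicit Defensive.

Import Order.TTheory GRing.Theory Num.Theory.
Import numFieldNormedType.Exports.

Local Open Scope classical_set_scope.
Local Open Scope ring_scope.

Section Matrices.
Variable R : realType.

(* The library norm `|v| on matrices is the sup norm. *)
Definition l2norm (n : nat) (v : 'cV[R]_n) : R :=
  Num.sqrt (\sum_(i < n) v i ord0 ^+ 2).

Definition qform (n : nat) (M : 'M[R]_n) (v : 'cV[R]_n) : R :=
  (v^T *m M *m v) ord0 ord0.

Definition posdefmx (n : nat) (M : 'M[R]_n) : Prop :=
  M^T = M /\ forall v : 'cV[R]_n, v != 0 -> 0 < qform M v.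

Definition possemidefmx (n : nat) (M : 'M[R]_n) : Prop :=
  M^T = M /\ forall v : 'cV[R]_n, 0 <= qform M v.

Definition negdefmx (n : nat) (M : 'M[R]_n) : Prop :=
  M^T = M /\ forall v : 'cV[R]_n, v != 0 -> qform M v < 0.

End Matrices.

Section Trajectories.
Variable R : realType.

Definition delayed (m p : nat) (d : 'I_m -> R) (z : R -> 'cV[R]_p) (t : R) :
    'cV[R]_(\sum_(i < m) p) :=
  \mxcol_(i < m) z (t - d i).

(* Classical solution of z'(t) = rhs(t) on [0, +oo[, with the initial value
   attained continuously. Values of z at negative times, which enter the
   delayed signals, are an unconstrained history. *)
Definition solves_ode (n : nat) (z rhs : R -> 'cV[R]_n) : Prop :=
  z t @[t --> 0^'+] --> z 0 /\
  forall t : R, 0 < t -> is_derive t 1 z (rhs t).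

(* Both notions depend only on the values at nonnegative times. *)
Definition lyapunov_stable (n : nat) (S : set (R -> 'cV[R]_n)) : Prop :=
  forall eps : R, 0 < eps ->
  exists2 del : R, 0 < del &
    forall e, S e -> l2norm (e 0) < del ->
    forall t : R, 0 <= t -> l2norm (e t) < eps.

Definition globally_attractive (n : nat) (S : set (R -> 'cV[R]_n)) : Prop :=
  forall e, S e -> e t @[t --> +oo] --> (0 : 'cV[R]_n).

Definition globally_stable (n : nat) (S : set (R -> 'cV[R]_n)) : Prop :=
  lyapunov_stable S /\ globally_attractive S.

End Trajectories.

Section CubicObserver.
Variables (R : realType) (n ny nu ng mu my : nat).

Let Uvec := 'cV[R]_(\sum_(i < mu) nu).
Let Yvec := 'cV[R]_(\sum_(i < my) ny).

Variables (A : 'M[R]_n) (C : 'M[R]_(ny, n)) (D : 'M[R]_(n, ng)).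
Variables (delta : 'I_mu -> R) (tau : 'I_my -> R).
Variables (fu : Uvec -> Yvec -> 'cV[R]_n) (fg : 'cV[R]_n -> Uvec -> Yvec -> 'cV[R]_ng).
Variable fL : 'cV[R]_n -> Uvec -> Yvec -> 'cV[R]_n.
Variables (G : 'M[R]_n) (J E N : 'M[R]_(n, ny)) (theta : 'M[R]_ny).

Definition cubic_term (v : 'cV[R]_n) : 'cV[R]_n :=
  qform (C^T *m theta *m C) v *: (N *m C *m v).

Definition system_observer_solution
    (u : R -> 'cV[R]_nu) (x : R -> 'cV[R]_n) (y : R -> 'cV[R]_ny)
    (w xhat : R -> 'cV[R]_n) : Prop :=
  let U := delayed delta u in
  let Y := delayed tau y in
  [/\ forall t, y t = C *m x t,
      forall t, xhat t = w t + E *m y t,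
      solves_ode x (fun t =>
        A *m x t + fu (U t) (Y t) + D *m fg (x t) (U t) (Y t)
        + fL (x t) (U t) (Y t)) &
      solves_ode w (fun t =>
        G *m w t + J *m y t + (1%:M - E *m C) *m fu (U t) (Y t)
        + (1%:M - E *m C) *m fL (xhat t) (U t) (Y t)
        - cubic_term (x t - xhat t))].

(* Trajectories of the error dynamics, over all inputs, initial conditions
   and histories for which the system and the observer have a solution on
   [0, +oo[. *)
Definition error_dynamics : set (R -> 'cV[R]_n) :=
  [set e | exists u x y w xhat,
    system_observer_solution u x y w xhat /\ e = (fun t => x t - xhat t)].

End CubicObserver.

(* Main.v *)
Require Import Defs.
From mathcomp Require Import all_boot all_order all_algebra.
From mathcomp Require Import all_classical all_reals all_analysis.
From mathcomp Require Import ring lra.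

Import Order.TTheory GRing.Theory Num.Theory.
Import numFieldNormedType.Exports.

Set Implicit Arguments.
Unset Strict Implicit.

Local Open Scope classical_set_scope.
Local Open Scope ring_scope.

(** Write T = I - EC. Then x - xhat = Tx - w, so the decoupling TD = 0 removes
    fg, the f_u terms of system and observer cancel, and the Sylvester condition
    TA = JC + GT turns the remaining linear part into G(Tx - w). Hence, whatever
    the input and the histories,

      e' = G e + T d + q(e) N C e,

    where d is the difference of the two values of fL and
    q(e) = (Ce)^T theta (Ce) >= 0 (error_solves_ode).

    The Lyapunov function is V(e) = e^T P e. Its derivative is the quadratic form
    of the block matrix at the stacked vector (e, d), plus
    beta (|d|^2 - gamma^2 |e|^2), plus q(e) e^T (PNC + C^T N^T P) e. The second
    summand is nonpositive by the Lipschitz bound and the third by negativity of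
    PNC + C^T N^T P, so V' <= -c |e|^2 for some c > 0 (lmi_decay).

    As V lies between two positive multiples of |e|^2, the function
    expR (k t) V(e(t)) is nonincreasing for a suitable k > 0. This yields
    |e(t)| <= K expR (- k' t) |e(0)| with constants common to all trajectories
    (quadratic_lyapunov), hence stability and attractivity at once
    (exponential_globally_stable).

    The lower bound of a definite form by a multiple of |.|^2 is obtained from
    the Cauchy-Schwarz inequality for that form (posdef_coercive), with no appeal
    to compactness of the sphere. *)

(** * Quadratic forms and the Euclidean norm *)

Section QuadraticForms.
Variable R : realType.

Definition bform (n : nat) (M : 'M[R]_n) (u v : 'cV[R]_n) : R :=
  (u^T *m M *m v) ord0 ord0.

Lemma bformE n (M : 'M[R]_n) u v :
  bform M u v = \sum_(i < n) \sum_(j < n) M i j * (u i ord0 * v j ord0).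
Proof.
rewrite /bform !mxE exchange_big; apply: eq_bigr => j _.
rewrite !mxE mulr_suml; apply: eq_bigr => i _; rewrite !mxE.
by rewrite mulrAC [RHS]mulrC.
Qed.

Lemma qformE n (M : 'M[R]_n) v : qform M v = bform M v v.
Proof. by []. Qed.

Lemma bformDl n (M : 'M[R]_n) u1 u2 v :
  bform M (u1 + u2) v = bform M u1 v + bform M u2 v.
Proof. by rewrite /bform linearD /= !mulmxDl mxE. Qed.

Lemma bformDr n (M : 'M[R]_n) u v1 v2 :
  bform M u (v1 + v2) = bform M u v1 + bform M u v2.
Proof. by rewrite /bform mulmxDr mxE. Qed.

Lemma bformZl n (M : 'M[R]_n) a u v : bform M (a *: u) v = a * bform M u v.
Proof. by rewrite /bform linearZ /= -!scalemxAl mxE. Qed.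

Lemma bformZr n (M : 'M[R]_n) a u v : bform M u (a *: v) = a * bform M u v.
Proof. by rewrite /bform -scalemxAr mxE. Qed.

Lemma bform_sym n (M : 'M[R]_n) u v : M^T = M -> bform M u v = bform M v u.
Proof.
move=> Ms; have -> : bform M u v = (u^T *m M *m v)^T ord0 ord0 by rewrite mxE.
by rewrite !trmx_mul trmxK Ms mulmxA.
Qed.

Lemma qform_addmx n (M N : 'M[R]_n) v : qform (M + N) v = qform M v + qform N v.
Proof. by rewrite /qform mulmxDr mulmxDl mxE. Qed.

Lemma qform_oppmx n (M : 'M[R]_n) v : qform (- M) v = - qform M v.
Proof. by rewrite /qform mulmxN mulNmx mxE. Qed.

Lemma qform0 n (M : 'M[R]_n) : qform M 0 = 0.
Proof. by rewrite /qform mulmx0 mxE. Qed.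

Lemma qform_mulmxr n (P M : 'M[R]_n) v : qform (P *m M) v = bform P v (M *m v).
Proof. by rewrite /qform /bform !mulmxA. Qed.

Lemma qform_mulmxl n (P M : 'M[R]_n) v :
  qform (M^T *m P) v = bform P (M *m v) v.
Proof. by rewrite /qform /bform trmx_mul !mulmxA. Qed.

Lemma qform_congr n m (M : 'M[R]_m) (B : 'M[R]_(m, n)) v :
  qform (B^T *m M *m B) v = qform M (B *m v).
Proof. by rewrite /qform trmx_mul !mulmxA. Qed.

Lemma qform_block n (A B B' D : 'M[R]_n) u v :
  qform (block_mx A B B' D) (col_mx u v) =
  qform A u + (u^T *m B *m v) ord0 ord0 + (v^T *m B' *m u) ord0 ord0 + qform D v.
Proof.
rewrite /qform tr_col_mx mul_row_block mul_row_col !mulmxDl !mxE.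
by rewrite !addrA; congr (_ + _); rewrite addrAC.
Qed.

Lemma sqr_l2norm n (v : 'cV[R]_n) : l2norm v ^+ 2 = \sum_i v i ord0 ^+ 2.
Proof. by rewrite sqr_sqrtr// sumr_ge0// => i _; exact: sqr_ge0. Qed.

Lemma l2norm_ge0 n (v : 'cV[R]_n) : 0 <= l2norm v.
Proof. exact: sqrtr_ge0. Qed.

Lemma qform_scalar n (a : R) (v : 'cV[R]_n) : qform a%:M v = a * l2norm v ^+ 2.
Proof.
rewrite /qform mul_mx_scalar -scalemxAl mxE sqr_l2norm; congr (_ * _).
by rewrite mxE; apply: eq_bigr => i _; rewrite mxE expr2.
Qed.

Lemma sqr_l2norm_col n m (u : 'cV[R]_n) (v : 'cV[R]_m) :
  l2norm (col_mx u v) ^+ 2 = l2norm u ^+ 2 + l2norm v ^+ 2.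
Proof.
rewrite !sqr_l2norm big_split_ord /=.
by congr (_ + _); apply: eq_bigr => i _; rewrite (col_mxEu, col_mxEd).
Qed.

Lemma normr_coord_le n (v : 'cV[R]_n) i : `|v i ord0| <= l2norm v.
Proof.
rewrite -sqrtr_sqr ler_wsqrtr// (bigD1 i)//= lerDl.
by rewrite sumr_ge0// => j _; exact: sqr_ge0.
Qed.

Lemma qform_bounded n (M : 'M[R]_n) :
  exists2 b, 0 < b & forall v, qform M v <= b * l2norm v ^+ 2.
Proof.
exists (1 + \sum_i \sum_j `|M i j|).
  by rewrite ltr_wpDr// !sumr_ge0// => i _; rewrite sumr_ge0.
move=> v; rewrite mulrDl mul1r; apply: ler_wpDl; first exact: sqr_ge0.
rewrite qformE bformE mulr_suml; apply: ler_sum => i _.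
rewrite mulr_suml; apply: ler_sum => j _.
rewrite (le_trans (ler_norm _))// !normrM ler_wpM2l// expr2.
by rewrite ler_pM// normr_coord_le.
Qed.

Lemma posdef_qform_ge0 n (M : 'M[R]_n) v : posdefmx M -> 0 <= qform M v.
Proof.
by move=> [_ Mpos]; have [->|/Mpos/ltW//] := eqVneq v 0; rewrite qform0.
Qed.

(** The form is nonnegative at a v - b u, where a = u^T M u and b = u^T M v;
    there it equals a (a (v^T M v) - b^2), and a > 0 can be divided out. *)
Lemma cauchy_schwarz n (M : 'M[R]_n) u v :
  posdefmx M -> bform M u v ^+ 2 <= qform M u * qform M v.
Proof.
move=> Mpd; have [Msym Mpos] := Mpd.
have [->|/Mpos u0] := eqVneq u 0.
  by rewrite qform0 mul0r /bform trmx0 !mul0mx mxE expr0n.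
have := posdef_qform_ge0 (qform M u *: v - bform M u v *: u) Mpd.
rewrite qformE -scaleNr bformDl !bformDr !bformZl !bformZr -!qformE.
rewrite (bform_sym v u Msym) => h.
by rewrite -subr_ge0 -(pmulr_rge0 _ u0); apply: le_trans h _; lra.
Qed.

Lemma posdef_unitmx n (M : 'M[R]_n) : posdefmx M -> M \in unitmx.
Proof.
move=> [_ Mpos]; rewrite -row_free_unit; apply: inj_row_free => v vM.
apply/eqP/negPn/negP => v0; have := Mpos v^T.
rewrite /qform trmxK vM mul0mx mxE ltxx => /(_ _)/notF; apply.
by rewrite -trmx0 (inj_eq trmx_inj).
Qed.

(** Each coordinate v_i is the M-inner product of v with M^-1 e_i, so by
    Cauchy-Schwarz v_i^2 is at most a constant multiple of v^T M v; summing over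
    i gives the bound. *)
Lemma posdef_coercive n (M : 'M[R]_n) : posdefmx M ->
  exists2 a, 0 < a & forall v, a * l2norm v ^+ 2 <= qform M v.
Proof.
move=> Mpd; pose r i := invmx M *m delta_mx i ord0 : 'cV[R]_n.
pose K := \sum_i qform M (r i).
have K1 : 0 < 1 + K.
  by rewrite ltr_wpDr// sumr_ge0// => i _; exact: posdef_qform_ge0.
(* K is the natural constant; adding 1 keeps it positive when n = 0. *)
exists (1 + K)^-1 => [|v]; first by rewrite invr_gt0.
rewrite mulrC ler_pdivrMr// mulrDr mulr1.
apply: ler_wpDl; first exact: posdef_qform_ge0.
rewrite sqr_l2norm mulr_sumr; apply: ler_sum => i _.
suff <- : bform M v (r i) = v i ord0 by exact: cauchy_schwarz.
rewrite /bform /r mulmxA -(mulmxA _ M) mulmxV ?posdef_unitmx// mulmx1.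
by rewrite -colE !mxE.
Qed.

Lemma negdef_coercive n (M : 'M[R]_n) : negdefmx M ->
  exists2 a, 0 < a & forall v, qform M v <= - (a * l2norm v ^+ 2).
Proof.
move=> [Msym Mneg]; have Npd : posdefmx (- M).
  by split=> [|v /Mneg]; rewrite ?linearN/= ?Msym// qform_oppmx oppr_gt0.
have [a a0 aM] := posdef_coercive Npd; exists a => // v.
by rewrite lerNr -qform_oppmx.
Qed.

Lemma negdef_qform_le0 n (M : 'M[R]_n) v : negdefmx M -> qform M v <= 0.
Proof.
by move=> [_ Mneg]; have [->|/Mneg/ltW//] := eqVneq v 0; rewrite qform0.
Qed.

End QuadraticForms.

(** * Differentiation and limits of vector-valued functions *)

Section Calculus.
Variable R : realType.

Lemma is_derive_coord m n (z : R -> 'M[R]_(m, n)) (t : R) (dz : 'M[R]_(m, n)) i j :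
  is_derive t 1 z dz -> is_derive t 1 (fun s => z s i j) (dz i j).
Proof.
move=> [zt <-]; split; first by move/derivable_mxP : zt; exact.
by rewrite derive_mx// mxE.
Qed.

Lemma is_derive_mx m n (z : R -> 'M[R]_(m, n)) (t : R) (dz : 'M[R]_(m, n)) :
  (forall i j, is_derive t 1 (fun s => z s i j) (dz i j)) ->
  is_derive t 1 z dz.
Proof.
move=> dzt; have zt : derivable z t 1 by apply/derivable_mxP => i j.
by split=> //; rewrite derive_mx//; apply/matrixP => i j; rewrite mxE derive_val.
Qed.

Lemma is_derive_mulmxl m n p (B : 'M[R]_(m, n)) (z : R -> 'M[R]_(n, p)) (t : R)
    (dz : 'M[R]_(n, p)) :
  is_derive t 1 z dz -> is_derive t 1 (fun s => B *m z s) (B *m dz).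
Proof.
move=> dzt; apply: is_derive_mx => i j.
rewrite (_ : (fun s => _) = \sum_k (cst (B i k) * (fun s => z s k j))); last first.
  by apply/funext => s; rewrite mxE fct_sumE.
rewrite mxE; apply: is_derive_sum => k.
have dk := is_derive_coord k j dzt.
by apply: is_derive_eq; rewrite scaler0 addr0.
Qed.

Section Limits.
Context (T : Type) (F : set_system T) {FF : Filter F}.

Lemma cvg_sum k (f : 'I_k -> T -> R) (l : 'I_k -> R) :
  (forall i, f i s @[s --> F] --> l i) ->
  \sum_i f i s @[s --> F] --> \sum_i l i.
Proof.
move=> fl; rewrite (_ : (fun _ => _) = \sum_i f i); last first.
  by apply/funext => x; rewrite fct_sumE.
by elim/big_ind2 : _ => // [|g a h b ga hb]; [exact: cvg_cst|exact: cvgD].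
Qed.

Lemma cvg_coord n m (z : T -> 'M[R]_(n, m)) (l : 'M[R]_(n, m)) i j :
  z s @[s --> F] --> l -> z s i j @[s --> F] --> l i j.
Proof. by move=> zl; exact: (cvg_comp _ _ zl (@coord_continuous _ n m i j l)). Qed.

Lemma cvg_mulmxl n m (B : 'M[R]_(m, n)) (z : T -> 'cV[R]_n) (l : 'cV[R]_n) :
  z s @[s --> F] --> l -> B *m z s @[s --> F] --> B *m l.
Proof.
move=> zl; apply/cvgrPdist_le => eps eps0.
have coord_near (ij : 'I_m * 'I_1) :
    \forall s \near F, `|(B *m l - B *m z s) ij.1 ij.2| <= eps.
  suff : (B *m z s) ij.1 ij.2 @[s --> F] --> (B *m l) ij.1 ij.2.
    by move=> /cvgrPdist_le/(_ _ eps0); apply: filterS => s; rewrite !mxE.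
  rewrite mxE; under eq_fun do rewrite mxE.
  by apply: cvg_sum => k; apply: cvgMl_tmp; exact: cvg_coord.
apply: filterS (filter_forall _ coord_near) => s sle.
by rewrite [leLHS]/Num.Def.normr/= mx_normrE (bigmax_le _ (ltW eps0)).
Qed.

Lemma cvg_qform n (P : 'M[R]_n) (z : T -> 'cV[R]_n) (l : 'cV[R]_n) :
  z s @[s --> F] --> l -> qform P (z s) @[s --> F] --> qform P l.
Proof.
move=> zl; rewrite qformE bformE; under eq_fun do rewrite qformE bformE.
apply: cvg_sum => i; apply: cvg_sum => j.
by apply: cvgMl_tmp; apply: cvgM; exact: cvg_coord.
Qed.

End Limits.

Lemma is_derive_qform n (P : 'M[R]_n) (z : R -> 'cV[R]_n) (t : R)
    (dz : 'cV[R]_n) :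
  is_derive t 1 z dz ->
  is_derive t 1 (fun s => qform P (z s)) (bform P dz (z t) + bform P (z t) dz).
Proof.
move=> dzt.
rewrite (_ : (fun s => _) = \sum_i \sum_j (cst (P i j) *
    ((fun s => z s i ord0) * (fun s => z s j ord0)))); last first.
  apply/funext => s; rewrite qformE bformE fct_sumE.
  by apply: eq_bigr => i _; rewrite fct_sumE.
rewrite !bformE -big_split; apply: is_derive_sum => i.
rewrite -big_split; apply: is_derive_sum => j.
have di := is_derive_coord i ord0 dzt; have dj := is_derive_coord j ord0 dzt.
apply: is_derive_eq; rewrite scaler0 addr0 /= /GRing.scale/=.
by rewrite -mulrDr addrC [z t j _ * _]mulrC.
Qed.

(** * Exponential decay and stability *)

(** The product expR (c t) V(t) has nonpositive derivative on ]0, +oo[. Right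
    continuity at 0 is what carries the comparison to the initial time, where V
    need not be differentiable. *)
Lemma gronwall_decay (V dV : R -> R) (c : R) :
  V t @[t --> 0^'+] --> V 0 ->
  (forall t : R, 0 < t -> is_derive t 1 V (dV t)) ->
  (forall t : R, 0 < t -> dV t <= - c * V t) ->
  forall t : R, 0 <= t -> V t <= expR (- (c * t)) * V 0.
Proof.
move=> V0 Vd dVle t t0.
pose W (s : R) := expR (c * s) * V s.
have Wd (s : R) : 0 < s -> is_derive s 1 W (expR (c * s) * (c * V s + dV s)).
  move=> s0; have Vs := Vd s s0.
  have cs : is_derive s 1 (fun r : R => c * r) c.
    rewrite -[X in is_derive _ _ _ X]mulr1.
    exact: (is_deriveZ c (is_derive_id s 1)).
  have es : is_derive s 1 (fun r => expR (c * r)) (expR (c * s) * c).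
    exact: (@is_derive1_comp R expR).
  apply: (is_derive_eq (is_deriveM _ _)).
  by rewrite /GRing.scale/=; ring.
suff : W t <= W 0.
  rewrite /W mulr0 expR0 mul1r => WtV0.
  by rewrite expRN [leRHS]mulrC ler_pdivlMr ?expR_gt0// mulrC.
apply: (@ler0_derive1_nincry R W 0) => // [s|s|].
- by rewrite in_itv/= andbT => /Wd[].
- rewrite in_itv/= andbT derive1E => s0; have [_ ->] := Wd s s0.
  rewrite pmulr_rle0 ?expR_gt0// -lerBrDl sub0r -mulNr.
  exact: dVle.
- apply/continuous_within_itvcyP; split=> [s|].
    rewrite in_itv/= andbT => /Wd[Ws _].
    exact/differentiable_continuous/derivable1_diffP.
  apply: cvgM => //; apply: cvg_at_right_filter.
  apply: continuous_comp; last exact: continuous_expR.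
  exact: mulrl_continuous.
Qed.

Lemma cvg_l2norm0 n (e : R -> 'cV[R]_n) :
  l2norm (e t) @[t --> +oo] --> (0 : R) -> e t @[t --> +oo] --> (0 : 'cV[R]_n).
Proof.
move=> e0; apply/cvgr0Pnorm_le => eps eps0.
near=> t; rewrite /Num.Def.normr/= mx_normrE (bigmax_le _ (ltW eps0))// => -[i j] _ /=.
rewrite ord1 (le_trans (normr_coord_le _ _))//.
near: t; move/cvgr0Pnorm_le : e0 => /(_ _ eps0); apply: filterS => t.
by rewrite ger0_norm// l2norm_ge0.
Unshelve. all: by end_near. Qed.

End Calculus.

Section LyapunovMethod.
Variables (R : realType) (n : nat) (S : set (R -> 'cV[R]_n)).

(** The point is that K and k do not depend on the trajectory: stability then
    holds with del = eps / K. *)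
Lemma exponential_globally_stable (K k : R) : 0 < K -> 0 < k ->
  (forall e, S e -> forall t : R, 0 <= t ->
    l2norm (e t) <= K * expR (- (k * t)) * l2norm (e 0)) ->
  globally_stable S.
Proof.
move=> K0 k0 Sexp; split=> [eps eps0|e Se].
  exists (eps / K) => [|e Se e0 t t0]; first exact: divr_gt0.
  apply: le_lt_trans (Sexp _ Se _ t0) _.
  rewrite mulrAC; apply: (@le_lt_trans _ _ (K * l2norm (e 0))).
    rewrite ler_piMr ?mulr_ge0 ?l2norm_ge0 ?(ltW K0)//.
    by rewrite -expR0 ler_expR oppr_le0 mulr_ge0 ?(ltW k0).
  by rewrite mulrC -ltr_pdivlMr.
apply: cvg_l2norm0.
apply: (@squeeze_cvgr _ _ _ _ (fun=> 0)
  (fun t => K * l2norm (e 0) * expR (- (k * t)))).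
- apply: filterS (nbhs_pinfty_ge (num_real 0)) => t t0.
  by rewrite l2norm_ge0/= mulrAC Sexp.
- exact: cvg_cst.
- rewrite -[X in _ --> X](mulr0 (K * l2norm (e 0))); apply: cvgMl_tmp.
  have kt : k * t @[t --> +oo] --> +oo by exact: gt0_cvgMry.
  exact: (cvg_comp _ _ kt (@cvgr_expR R)).
Qed.

(** With a |v|^2 <= v^T P v <= b |v|^2, the decrease condition gives
    V' <= - (c / b) V, hence a |e(t)|^2 <= expR (- (c / b) t) b |e(0)|^2. The
    constants for |e(t)| come from taking square roots. *)
Lemma quadratic_lyapunov (P : 'M[R]_n) (c : R) : posdefmx P -> 0 < c ->
  (forall e, S e -> exists2 f, solves_ode e f & forall t : R, 0 < t ->
    bform P (f t) (e t) + bform P (e t) (f t) <= - (c * l2norm (e t) ^+ 2)) ->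
  globally_stable S.
Proof.
move=> Ppd c0 Sdecr.
have [a a0 aP] := posdef_coercive Ppd; have [b b0 Pb] := qform_bounded P.
have k0 : 0 < c / b / 2 by rewrite !divr_gt0.
have K0 : 0 < b / a by rewrite divr_gt0.
apply: (@exponential_globally_stable (Num.sqrt (b / a)) (c / b / 2)) => //.
  by rewrite sqrtr_gt0.
move=> e /Sdecr[f [ecvg eode] fdecr] t t0.
have Vt : qform P (e t) <= expR (- (c / b * t)) * qform P (e 0).
  apply: (@gronwall_decay R (fun t => qform P (e t))) t0.
  - exact: cvg_qform.
  - by move=> s s0; exact/is_derive_qform/eode.
  - move=> s s0; apply: le_trans (fdecr _ s0) _.
    by rewrite mulNr lerN2 mulrAC ler_pdivrMr// -mulrA ler_pM2l// mulrC Pb.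
rewrite -ler_sqr ?nnegrE ?mulr_ge0 ?l2norm_ge0 ?sqrtr_ge0 ?expR_ge0//.
rewrite !exprMn (sqr_sqrtr (ltW K0)) [expR _ ^+ 2]expr2 -expRD.
rewrite (_ : _ + _ = - (c / b * t)); last by field; rewrite gt_eqF.
rewrite -(ler_pM2l a0); apply: le_trans (aP _) (le_trans Vt _).
rewrite mulrA [X in _ <= X * _](_ : _ = expR (- (c / b * t)) * b); last first.
  by field; rewrite gt_eqF.
by rewrite -[leRHS]mulrA ler_pM2l ?expR_gt0.
Qed.

End LyapunovMethod.

(** * The error dynamics of the cubic observer *)

Section ErrorDynamics.
Variables (R : realType) (n ny nu ng mu my : nat).
Variables (C : 'M[R]_(ny, n)) (G : 'M[R]_n) (E N : 'M[R]_(n, ny)).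
Variable theta : 'M[R]_ny.

(** Since e = Tx - w with T = I - EC, the right-hand side is T x' - w', in which
    T only matters through TD = 0 and TA = JC + GT. *)
Lemma error_solves_ode (A : 'M[R]_n) (D : 'M[R]_(n, ng)) (J : 'M[R]_(n, ny))
    (delta : 'I_mu -> R) (tau : 'I_my -> R) fu fg fL u x y w xhat :
  (1%:M - E *m C) *m A - J *m C - G *m (1%:M - E *m C) = 0 ->
  (1%:M - E *m C) *m D = 0 ->
  @system_observer_solution R n ny nu ng mu my
    A C D delta tau fu fg fL G J E N theta u x y w xhat ->
  solves_ode (fun t => x t - xhat t) (fun t =>
    G *m (x t - xhat t) +
    (1%:M - E *m C) *m (fL (x t) (delayed delta u t) (delayed tau y t) -
                        fL (xhat t) (delayed delta u t) (delayed tau y t)) +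
    cubic_term C N theta (x t - xhat t)).
Proof.
rewrite /system_observer_solution; set T := 1%:M - E *m C.
move=> sylv TD [yE xhatE [x0 xode] [w0 wode]].
have eE t : x t - xhat t = T *m x t - w t.
  by rewrite xhatE yE mulmxBl mul1mx mulmxA opprD addrA addrAC.
have TA : T *m A = J *m C + G *m T.
  by apply/eqP; rewrite -subr_eq0 opprD addrA sylv.
split=> [|t t0].
  rewrite eE; under eq_fun do rewrite eE.
  by apply: cvgB => //; exact: cvg_mulmxl.
rewrite (_ : (fun t => x t - xhat t) = (fun t => T *m x t) - w); last first.
  by apply/funext => s; rewrite eE.
apply: is_derive_eq (is_deriveB (is_derive_mulmxl _ (xode t t0)) (wode t t0)) _.
clearbody T; rewrite /= !eE yE !mulmxDr !mulmxN !mulmxA TA TD mul0mx addr0.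
rewrite mulmxDl; move: (J *m C *m x t) (G *m T *m x t) (G *m w t) => Jy GTx Gw.
move: (T *m fu _ _) (T *m fL (x t) _ _) (T *m fL _ _ _) => Tfu TfLx TfLxhat.
move: (cubic_term _ _ _ _) => cubic.
(* What remains is an identity in an additive group, checked entrywise. *)
by apply/matrixP => i j; rewrite !mxE; ring.
Qed.

(** The S-procedure: the constraint |d|^2 <= gamma^2 |e|^2 is weighted by beta,
    which is exactly how gamma^2 beta I and - beta I enter the block matrix. *)
Lemma lmi_decay (P : 'M[R]_n) (gamma beta : R) :
  posdefmx P -> 0 < beta ->
  negdefmx (block_mx
    (P *m G + G^T *m P + (gamma ^+ 2 * beta)%:M) (P *m (1%:M - E *m C))
    ((1%:M - E *m C)^T *m P)                     (- beta%:M)) ->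
  negdefmx (P *m N *m C + C^T *m N^T *m P) ->
  possemidefmx theta ->
  exists2 c, 0 < c & forall e d, l2norm d <= gamma * l2norm e ->
    let f := G *m e + (1%:M - E *m C) *m d + cubic_term C N theta e in
    bform P f e + bform P e f <= - (c * l2norm e ^+ 2).
Proof.
set T := 1%:M - E *m C => Ppd beta0 /negdef_coercive[c c0 cM] NC [_ th].
exists c => // e d de /=.
have := cM (col_mx e d); rewrite qform_block sqr_l2norm_col.
rewrite !qform_addmx qform_oppmx !qform_scalar qform_mulmxr qform_mulmxl.
have -> : (e^T *m (P *m T) *m d) ord0 ord0 = bform P e (T *m d).
  by rewrite /bform !mulmxA.
have -> : (d^T *m (T^T *m P) *m e) ord0 ord0 = bform P (T *m d) e.
  by rewrite /bform trmx_mul !mulmxA.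
have /= := negdef_qform_le0 e NC.
rewrite -mulmxA -trmx_mul qform_addmx qform_mulmxr qform_mulmxl => NCe.
have q0 : 0 <= qform (C^T *m theta *m C) e by rewrite qform_congr.
have d2 : l2norm d ^+ 2 <= gamma ^+ 2 * l2norm e ^+ 2.
  rewrite -exprMn ler_sqr// nnegrE ?l2norm_ge0//.
  exact: le_trans (l2norm_ge0 d) de.
have bd2 := ler_wpM2l (ltW beta0) d2.
have cd2 : 0 <= c * l2norm d ^+ 2 by rewrite mulr_ge0 ?sqr_ge0// ltW.
have qNC := mulr_ge0_le0 q0 NCe.
rewrite /cubic_term !bformDl !bformDr bformZl bformZr.
move: qNC cd2 bd2; lra.
Qed.

End ErrorDynamics.

Theorem theorem1 (R : realType) (n ny nu ng mu my : nat)
  (A : 'M[R]_n) (C : 'M[R]_(ny, n)) (D : 'M[R]_(n, ng))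
  (delta : 'I_mu -> R) (tau : 'I_my -> R)
  (delta_ge0 : forall i, 0 <= delta i) (tau_ge0 : forall i, 0 <= tau i)
  (fu : 'cV[R]_(\sum_(i < mu) nu) -> 'cV[R]_(\sum_(i < my) ny) -> 'cV[R]_n)
  (fg : 'cV[R]_n -> 'cV[R]_(\sum_(i < mu) nu) -> 'cV[R]_(\sum_(i < my) ny) ->
        'cV[R]_ng)
  (fL : 'cV[R]_n -> 'cV[R]_(\sum_(i < mu) nu) -> 'cV[R]_(\sum_(i < my) ny) ->
        'cV[R]_n)
  (gamma : R) (gamma_gt0 : 0 < gamma)
  (fL_lipschitz : forall x1 x2 U Y,
     l2norm (fL x1 U Y - fL x2 U Y) <= gamma * l2norm (x1 - x2))
  (G : 'M[R]_n) (J E N : 'M[R]_(n, ny)) (theta : 'M[R]_ny)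
  (theta_ge0 : possemidefmx theta)
  (no_other_equilibrium :
     ~ exists v : 'cV[R]_n, v != 0 /\ G *m v + cubic_term C N theta v = 0)
  (lmi : exists (P : 'M[R]_n) (beta : R),
     [/\ posdefmx P,
         0 < beta,
         negdefmx (block_mx
           (P *m G + G^T *m P + (gamma ^+ 2 * beta)%:M) (P *m (1%:M - E *m C))
           ((1%:M - E *m C)^T *m P)                     (- beta%:M)) &
         negdefmx (P *m N *m C + C^T *m N^T *m P)])
  (sylvester :
     (1%:M - E *m C) *m A - J *m C - G *m (1%:M - E *m C) = 0)
  (decoupling : (1%:M - E *m C) *m D = 0) :
  globally_stable (error_dynamics A C D delta tau fu fg fL G J E N theta).
Proof.
have [P [beta [Ppd beta0 M_neg NC_neg]]] := lmi.
have [c c0 decay] := lmi_decay Ppd beta0 M_neg NC_neg theta_ge0.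
apply: (quadratic_lyapunov Ppd c0) => _ [u [x [y [w [xhat [sol ->]]]]]].
by eexists; [exact: error_solves_ode sol|move=> t _; exact: decay].
Qed.
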